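(* Let $V$ be a JB-algebra and let $\gamma\subset\mathrm{Str}(V)$ be a smooth path. Let $v_t=\gamma_t^{-1}\gamma_t'=L_{y_t}+d_t$ with $d_t$ a path in $\mathrm{Der}(V)$ and $y_t$ a path in $V$. Then the vector field $\mu_t=\gamma_t(L_{x_t}+D_t)$ along $\gamma$ (with $x_t$ a smooth path in $V$ and $D_t$ a smooth path in $\mathrm{Der}(V)$) is parallel along $\gamma$ if and only if $$L_x'=-\tfrac32[d,L_x]+\tfrac12[L_y,D]\quad\text{inside }\mathbb L,$$ $$D'=-\tfrac12[L_y,L_x]-\tfrac12[d,D]\quad\text{inside }\mathrm{Der}(V).$$
   Context: A JB-algebra is a real Banach space $V$ with a bilinear commutative product $\circ$ and unit $1$ such that $x^2\circ(x\circ y)=x\circ(x^2\circ y)$, $\|x\circ y\|\le\|x\|\|y\|$, $\|x^2\|=\|x\|^2$ and $\|x^2\|\le\|x^2+y^2\|$. $B(V)$ is the algebra of bounded linear operators on $V$, $GL(V)$ its invertible elements. $L_xy=x\circ y$, $U_x=2L_x^2-L_{x^2}$. The structure group $\mathrm{Str}(V)$ is the set of $g\in GL(V)$ for which there is $g^*\in GL(V)$ with $U_{gx}=gU_xg^*$ for all $x\in V$; it is an embedded Banach-Lie subgroup of $GL(V)$ with Lie algebra $\mathfrak{str}(V)=\mathbb L\oplus\mathrm{Der}(V)$, where $\mathbb L=\{L_x:x\in V\}$ and $\mathrm{Der}(V)$ is the space of $D\in B(V)$ with $D(x\circ y)=Dx\circ y+x\circ Dy$. One has $[\mathbb L,\mathbb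 L]\subset\mathrm{Der}(V)$, $[\mathbb L,\mathrm{Der}(V)]\subset\mathbb L$, $[\mathrm{Der}(V),\mathrm{Der}(V)]\subset\mathrm{Der}(V)$. $T_g\mathrm{Str}(V)=g\,\mathfrak{str}(V)\subset B(V)$. For $H=L_x+D\in\mathfrak{str}(V)$ put $H^{\dagger}=L_x-D$. The connection on $\mathrm{Str}(V)$ is the one induced by the left-invariant quadratic spray $F_g(gH)=g(H^2+H^{\dagger}H-HH^{\dagger})$, with Christoffel operator $$\Gamma_g(gH,gK)=\tfrac12 g\,(HK+KH+H^{\dagger}K+K^{\dagger}H-HK^{\dagger}-KH^{\dagger}),\quad H,K\in\mathfrak{str}(V).$$ A vector field $\mu$ along $\gamma$ is parallel if $\mu'=\Gamma_{\gamma}(\gamma',\mu)$. Brackets are commutators in $B(V)$. *)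

(* Defs.v *)
From HB Require Import structures.
From mathcomp Require Import all_boot all_order all_algebra.
From mathcomp Require Import all_classical all_reals all_analysis.
Set Implicit Arguments.
Unset Strict Implicit.
Unset Printing Implicit Defensive.
Import Order.TTheory GRing.Theory Num.Theory.
Import numFieldNormedType.Exports.
Local Open Scope classical_set_scope.
Local Open Scope ring_scope.

Section BoundedOperators.
Context {R : realType} {V : normedModType R}.

Definition bounded_op : {pred V -> V} := fun f =>
  `[< linear f /\ exists M : R, forall x, `|f x| <= M * `|x| >].

Fact bounded_op_submod_closed : submod_closed bounded_op.
Proof.
have val0 u : (0 : V -> V) u = 0 by [].
have valD (a : R) (f g : V -> V) u : (a *: f + g) u = a *: f u + g u by [].
split=> [|a f g].
  apply/asboolP; split=> [a x y|]; first by rewrite !val0 scaler0 addr0.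
  by exists 0 => x; rewrite !val0 normr0 mul0r.
move=> /asboolP[lf [M hM]] /asboolP[lg [N hN]]; apply/asboolP; split.
  move=> b x y; rewrite !valD lf lg !scalerDr !scalerA (mulrC a b).
  by rewrite addrACA.
exists (`|a| * M + N) => x; rewrite !valD (le_trans (ler_normD _ _))//.
by rewrite normrZ mulrDl lerD// -mulrA ler_wpM2l.
Qed.

HB.instance Definition _ :=
  GRing.isSubmodClosed.Build R (V -> V) bounded_op bounded_op_submod_closed.

End BoundedOperators.

Record bop (R : realType) (V : normedModType R) := Bop {
  bop_val :> V -> V ;
  bop_valP : bop_val \in bounded_op }.
Arguments Bop {R V}.

Section BoundedOperatorAlgebra.
Context {R : realType} {V : normedModType R}.
Implicit Types f g h : bop V.

HB.instance Definition _ := [isSub for @bop_val R V].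
HB.instance Definition _ := [Choice of bop V by <:].
HB.instance Definition _ := [SubChoice_isSubLmodule of bop V by <:].

Lemma bopE f g : (forall x, f x = g x) -> f = g.
Proof. by move=> fg; apply/val_inj/funext. Qed.

Lemma bop_is_linear f : linear f.
Proof. by have /asboolP[] := bop_valP f. Qed.

HB.instance Definition _ f :=
  GRing.isLinear.Build R V V _ (bop_val f) (bop_is_linear f).

Lemma bop_addE f g x : (f + g) x = f x + g x. Proof. by []. Qed.
Lemma bop_oppE f x : (- f) x = - f x. Proof. by []. Qed.
Lemma bop_scaleE (a : R) f x : (a *: f) x = a *: f x. Proof. by []. Qed.
Lemma bop_zeroE x : (0 : bop V) x = 0. Proof. by []. Qed.

Definition opnorm f : R := sup [set `|f x| | x in [set x : V | `|x| <= 1]].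

Lemma opnorm_has_sup f :
  has_sup [set `|f x| | x in [set x : V | `|x| <= 1]].
Proof.
split; first by exists `|f 0|; exists 0 => //=; rewrite normr0.
have /asboolP[_ [M hM]] := bop_valP f.
exists `|M| => _ [x /= x1 <-]; apply: (le_trans (hM x)).
rewrite (le_trans (ler_norm _))// normrM normr_id.
by rewrite -[leRHS]mulr1 ler_wpM2l.
Qed.

Lemma opnorm_ge0 f : 0 <= opnorm f.
Proof.
apply: (ub_le_sup (proj2 (opnorm_has_sup f))).
by exists 0; rewrite /= ?normr0// linear0 normr0.
Qed.

Lemma opnormP f x : `|f x| <= opnorm f * `|x|.
Proof.
have [->|x0] := eqVneq x 0; first by rewrite linear0 !normr0 mulr0.
rewrite -ler_pdivrMr ?normr_gt0//.
apply: (ub_le_sup (proj2 (opnorm_has_sup f))).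
exists (`|x|^-1 *: x); rewrite /=.
  by rewrite normrZ normfV normr_id mulVf// normr_eq0.
by rewrite linearZ/= normrZ normfV normr_id mulrC.
Qed.

Lemma opnorm_le f (M : R) : 0 <= M -> (forall x, `|f x| <= M * `|x|) ->
  opnorm f <= M.
Proof.
move=> M0 hM; apply: ge_sup; first by case: (opnorm_has_sup f).
move=> _ [x /= x1 <-]; apply: (le_trans (hM x)).
by rewrite -[leRHS]mulr1 ler_wpM2l.
Qed.

Fact opnormD f g : opnorm (f + g) <= opnorm f + opnorm g.
Proof.
apply: opnorm_le => [|x]; first by rewrite addr_ge0// opnorm_ge0.
by rewrite bop_addE (le_trans (ler_normD _ _))// mulrDl lerD// opnormP.
Qed.

Fact opnormZ (a : R) f : opnorm (a *: f) = `|a| * opnorm f.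
Proof.
have le_opnormZ (b : R) g : opnorm (b *: g) <= `|b| * opnorm g.
  apply: opnorm_le => [|x]; first by rewrite mulr_ge0// opnorm_ge0.
  by rewrite bop_scaleE normrZ -mulrA ler_wpM2l// opnormP.
apply/eqP; rewrite eq_le le_opnormZ/=.
have [->|a0] := eqVneq a 0; first by rewrite normr0 mul0r opnorm_ge0.
rewrite -ler_pdivlMl ?normr_gt0// -normfV.
by rewrite -{1}[f](scalerK a0) le_opnormZ.
Qed.

Fact opnorm0_eq0 f : opnorm f = 0 -> f = 0.
Proof.
move=> f0; apply: bopE => x; rewrite bop_zeroE; apply/eqP.
by rewrite -normr_eq0 eq_le normr_ge0 andbT (le_trans (opnormP f x))// f0 mul0r.
Qed.

HB.instance Definition _ :=
  Lmodule_isNormed.Build R (bop V) opnormD opnormZ opnorm0_eq0.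

Lemma bop_normE f : `|f| = opnorm f. Proof. by []. Qed.

Fact bop_id_subproof : (id : V -> V) \in bounded_op.
Proof. by apply/asboolP; split=> //; exists 1 => x; rewrite mul1r. Qed.

Definition bop_id : bop V := Bop id bop_id_subproof.

Fact bop_comp_subproof f g : (f \o g : V -> V) \in bounded_op.
Proof.
apply/asboolP; split=> [a x y|]; first by rewrite /= !linearP.
exists (opnorm f * opnorm g) => x /=.
by rewrite (le_trans (opnormP f _))// -mulrA ler_wpM2l ?opnorm_ge0 ?opnormP.
Qed.

Definition bop_comp f g : bop V := Bop (f \o g) (bop_comp_subproof f g).

Fact bop_compA : associative bop_comp. Proof. by move=> f g h; apply: bopE. Qed.
Fact bop_comp1l : left_id bop_id bop_comp.
Proof. by move=> f; apply: bopE. Qed.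
Fact bop_comp1r : right_id bop_id bop_comp.
Proof. by move=> f; apply: bopE. Qed.
Fact bop_compDl : left_distributive bop_comp +%R.
Proof. by move=> f g h; apply: bopE. Qed.
Fact bop_compDr : right_distributive bop_comp +%R.
Proof. by move=> f g h; apply: bopE => x; exact: (linearD f). Qed.

HB.instance Definition _ := GRing.Zmodule_isPzRing.Build (bop V)
  bop_compA bop_comp1l bop_comp1r bop_compDl bop_compDr.

Lemma bop_mulE f g x : (f * g) x = f (g x). Proof. by []. Qed.
Lemma bop_oneE x : (1 : bop V) x = x. Proof. by []. Qed.

Lemma bop_scaleAl (a : R) f g : a *: (f * g) = a *: f * g.
Proof. by apply: bopE => x; rewrite bop_mulE !bop_scaleE. Qed.
Lemma bop_scaleAr (a : R) f g : a *: (f * g) = f * (a *: g).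
Proof. by apply: bopE => x; rewrite bop_mulE !bop_scaleE linearZ. Qed.

Lemma opnormM f g : `|f * g| <= `|f| * `|g|.
Proof.
rewrite !bop_normE; apply: opnorm_le => [|x].
  by rewrite mulr_ge0// opnorm_ge0.
by rewrite bop_mulE (le_trans (opnormP f _))// -mulrA ler_wpM2l ?opnorm_ge0 ?opnormP.
Qed.

Definition bracket f g : bop V := f * g - g * f.

Definition is_inverse f g := f * g = 1 /\ g * f = 1.

Definition GL : set (bop V) := [set g | exists h, is_inverse g h].

(* 0 outside GL *)
Definition bop_inv g : bop V := xget 0 [set h | is_inverse g h].

End BoundedOperatorAlgebra.

(* The derivative is relative to J: it is two-sided at interior points and
   one-sided at the endpoints that belong to J. *)
Section SmoothPaths.
Context {R : realType} {W : normedModType R}.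
Implicit Types (J : set R) (f : R -> W).

Definition diff_quot f (t s : R) : W := (s - t)^-1 *: (f s - f t).

Definition derivable_on J f (t : R) : Prop :=
  cvg (diff_quot f t s @[s --> within J t^']).

Definition derive_on J f (t : R) : W :=
  lim (diff_quot f t s @[s --> within J t^']).

Definition smooth_on J f : Prop :=
  forall (n : nat) (t : R), J t -> derivable_on J (iter n (derive_on J) f) t.

End SmoothPaths.

HB.mixin Record isJBAlgebra (R : realType) V of CompleteNormedModule R V := {
  jmul : V -> V -> V ;
  jone : V ;
  jmulC : commutative jmul ;
  jmul_linear : forall x, linear (jmul x) ;
  jmul1 : left_id jone jmul ;
  jordan_identity : forall x y,
    jmul (jmul x x) (jmul x y) = jmul x (jmul (jmul x x) y) ;
  jnormM : forall x y, `|jmul x y| <= `|x| * `|y| ;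
  jnorm_sqr : forall x, `|jmul x x| = `|x| ^+ 2 ;
  jnorm_sqrD : forall x y, `|jmul x x| <= `|jmul x x + jmul y y| }.

#[short(type="jbAlgType")]
HB.structure Definition JBAlgebra (R : realType) :=
  {V of CompleteNormedModule R V & isJBAlgebra R V}.

Section StructureGroup.
Context {R : realType} {V : jbAlgType R}.
Implicit Types (x y : V) (g h A B H K D : bop V) (J : set R).

Fact Lmul_subproof x : jmul x \in bounded_op.
Proof.
by apply/asboolP; split; [exact: jmul_linear|exists `|x| => y; exact: jnormM].
Qed.

Definition Lmul x : bop V := Bop (jmul x) (Lmul_subproof x).

Definition Uop x : bop V := 2 *: Lmul x ^+ 2 - Lmul (jmul x x).

Definition Str : set (bop V) := [set g | GL g /\
  exists2 g', GL g' & forall x, Uop (g x) = g * Uop x * g'].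

Definition Lset : set (bop V) := range Lmul.

Definition Der : set (bop V) :=
  [set D | forall x y, D (jmul x y) = jmul (D x) y + jmul x (D y)].

(* H^dagger = L_x - D for H = L_x + D in str(V); 0 outside str(V) *)
Definition dagger H : bop V := xget 0
  [set K | exists x D, [/\ Der D, H = Lmul x + D & K = Lmul x - D]].

(* The tangent vectors at g are A = g H and B = g K with H, K in str(V). *)
Definition christoffel g A B : bop V :=
  let H := bop_inv g * A in
  let K := bop_inv g * B in
  2^-1 *: (g * (H * K + K * H + dagger H * K + dagger K * H
                - H * dagger K - K * dagger H)).

Definition parallel_along J (gamma mu : R -> bop V) : Prop :=
  forall t, J t ->
    derive_on J mu t = christoffel (gamma t) (derive_on J gamma t) (mu t).

(* A = B, as an equation in the space S *)
Definition eq_inside (S : set (bop V)) A B : Prop := [/\ S A, S B & A = B].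

End StructureGroup.

(* Main.v *)
Require Import Defs.
From HB Require Import structures.
From mathcomp Require Import all_boot all_order all_algebra.
From mathcomp Require Import all_classical all_reals all_analysis.
Import Order.TTheory GRing.Theory Num.Theory.
Import numFieldNormedType.Exports.
Local Open Scope classical_set_scope.
Local Open Scope ring_scope.

(** Write [K = L_x + D] and [v = L_y + d], so that [gamma' = gamma v] and the
    field is [mu = gamma K]. Composition of bounded operators is jointly
    continuous, so Leibniz' rule holds and [mu' = gamma (v K + K')].
    Expanding the Christoffel operator with [v^dagger = L_y - d] and
    [K^dagger = L_x - D] gives (lemma [christoffel_translate])

      Gamma (gamma v) (gamma K)
        = gamma (v K + (- 3/2 [d, L_x] + 1/2 [L_y, D])
                     + (- 1/2 [L_y, L_x] - 1/2 [d, D])).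

    As [gamma] is invertible, parallelism amounts to the single equation saying
    that [K' = L_x' + D'] is the sum of the two parenthesized operators. The
    first of them is a multiplication operator, since [[D, L_x] = L_(D x)]
    ([bracket_Der_Lmul]), and the second one is a derivation, since brackets of
    multiplications are derivations ([Der_bracket_Lmul]). On the other side,
    [L_x'] is the multiplication by [x'], and [D'] is a derivation because
    derivations are closed under limits ([Der_derive_on]). Finally the sum of
    the multiplications and the derivations is direct, because a derivation
    kills the unit while [L_x 1 = x] ([Lmul_add_Der_inj]); so the single
    equation splits into the two of the theorem.

    The only non-formal algebraic fact is that [[L_a, L_b]] is a derivation. It
    comes from the Jordan identity by polarization: one side of the polarized
    identity is symmetric in its four arguments, hence so is the other, and
    this symmetry is the derivation rule. *)

(** * Polarization *)

(** Proves identities between signed sums of atoms in an abelian group: all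
    terms go to the left, and the head of the sum is repeatedly paired with its
    opposite, which [addrCA] carries leftwards one step at a time. *)
Ltac cancel_terms :=
  apply/eqP; rewrite -subr_eq0; apply/eqP;
  rewrite ?opprD ?opprK -?addrA -[LHS]addr0 -?addrA;
  repeat first
    [ rewrite addKr
    | rewrite addNKr
    | match goal with
      | |- - ?a + _ = _ => rewrite (addrCA _ a)
      | |- ?a + _ = _ => rewrite (addrCA _ (- a))
      end ];
  try reflexivity.

(** With [G x z] the part of [T (x + z) (x + z) (x + z)] of degree two in [x],
    comparing [x + z] with [x - z] gives [G x z = 0]; the polarization of [G]
    in its quadratic argument is then twice the cyclic sum. *)
Lemma polarization {R : numFieldType} {U W : lmodType R}
    (T : U -> U -> U -> W) :
    (forall a b c, T a b c = T b a c) ->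
    (forall b c, {morph (fun a => T a b c) : u v / u - v}) ->
    (forall a b, {morph T a b : u v / u - v}) ->
    (forall a, T a a a = 0) ->
  forall a b c, T a b c + T b c a + T c a b = 0.
Proof.
move=> TC TBl TBr T0 a b c.
have TN x y z : (T (- x) y z = - T x y z) * (T x y (- z) = - T x y z).
  have T0l u v : T 0 u v = 0 by rewrite -(subrr 0) TBl subrr.
  have T0r u v : T u v 0 = 0 by rewrite -(subrr 0) TBr subrr.
  by split; rewrite -sub0r ?TBl ?TBr ?T0l ?T0r sub0r.
have TD x y u v : (T (x + y) u v = T x u v + T y u v)
    * (T u (x + y) v = T u x v + T u y v) * (T u v (x + y) = T u v x + T u v y).
  have TDl z w : T (x + y) z w = T x z w + T y z w.
    by rewrite -{1}[y]opprK TBl TN opprK.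
  by split; [split; rewrite ?(TC u) TDl|rewrite -{1}[y]opprK TBr TN opprK].
have half (w : W) : w + w = 0 -> w = 0.
  by rewrite -mulr2n -scaler_nat => /eqP; rewrite scaler_eq0 pnatr_eq0 => /eqP.
pose G x z := T x x z + (T x z x + T x z x).
have G0 x z : G x z = 0.
  have E u v : G u v + G v u = 0.
    have := T0 (u + v); rewrite !TD !T0 (TC v u) !add0r !addr0 => <-.
    rewrite /G (TC v u); cancel_terms.
  apply: half; have <- : G x z + G z x - (G x (- z) + G (- z) x) = 0.
    by rewrite !E subrr.
  rewrite /G !(TN, TC _ (- z)) !(TC z x) ?opprK; cancel_terms.
apply: half.
have <- : G (a + b) c - G a c - G b c = 0 by rewrite !G0 !subr0.
rewrite /G !TD (TC c a) (TC b a); cancel_terms.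
Qed.

(** * Brackets and inverses of bounded operators *)

Section BoundedOperators.
Context {R : realType} {V : normedModType R}.
Implicit Types f g : bop V.

Lemma bracketC f g : bracket f g = - bracket g f.
Proof. by rewrite /bracket opprB. Qed.

Lemma bracketE f g (x : V) : bracket f g x = f (g x) - g (f x).
Proof. by []. Qed.

Lemma bop_morphD f (x y : V) : f (x + y) = f x + f y.
Proof. exact: linearD. Qed.

Lemma bop_invP g : GL g -> is_inverse g (bop_inv g).
Proof. exact: (@xgetPex _ (0 : bop V)). Qed.

Lemma bop_invK g f : GL g -> bop_inv g * (g * f) = f.
Proof. by move=> /bop_invP[_ Vg]; rewrite mulrA Vg mul1r. Qed.

End BoundedOperators.

(** * Multiplications and derivations of a JB-algebra *)

Section JordanOperators.
Context {R : realType} {V : jbAlgType R}.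
Implicit Types (x y : V) (D : bop V).

HB.instance Definition _ (x : V) :=
  GRing.isLinear.Build R V V _ (jmul x) (jmul_linear x).

Lemma jmulDl (u v w : V) : jmul (u + v) w = jmul u w + jmul v w.
Proof. by rewrite !(jmulC _ w) linearD. Qed.

Lemma jmulBl (u v w : V) : jmul (u - v) w = jmul u w - jmul v w.
Proof. by rewrite !(jmulC _ w) linearB. Qed.

Lemma jmulDr (u v w : V) : jmul u (v + w) = jmul u v + jmul u w.
Proof. exact: linearD. Qed.

Lemma jmulBr (u v w : V) : jmul u (v - w) = jmul u v - jmul u w.
Proof. exact: linearB. Qed.

Lemma Lmul_is_linear : linear (@Lmul R V).
Proof.
by move=> a x y; apply: bopE => z; rewrite /= jmulC linearP /= !(jmulC z).
Qed.

HB.instance Definition _ :=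
  GRing.isLinear.Build R V (bop V) _ (@Lmul R V) Lmul_is_linear.

Lemma LmulB (u v : V) : Lmul (u - v) = Lmul u - Lmul v.
Proof. exact: linearB. Qed.

Lemma LmulZ (a : R) (u : V) : Lmul (a *: u) = a *: Lmul u.
Proof. exact: linearZ. Qed.

(** The polarization of [x^2 (x d) - x (x^2 d)] in [x]. *)
Lemma jordan_identity_polarized (a b c d : V) :
  jmul (jmul a b) (jmul c d) + jmul (jmul b c) (jmul a d)
    + jmul (jmul c a) (jmul b d)
  = jmul c (jmul (jmul a b) d) + jmul a (jmul (jmul b c) d)
    + jmul b (jmul (jmul c a) d).
Proof.
pose T u v w := jmul (jmul u v) (jmul w d) - jmul w (jmul (jmul u v) d).
have := @polarization R V V T _ _ _ _ a b c; rewrite /T => H.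
apply/eqP; rewrite -subr_eq0; apply/eqP; rewrite -[RHS]H; last first.
- by move=> u; rewrite jordan_identity subrr.
- by move=> u v p q /=; rewrite !jmulBl linearB /=; cancel_terms.
- by move=> u v p q /=; rewrite !jmulBl !linearB /=; cancel_terms.
- by move=> u v w; rewrite (jmulC u).
cancel_terms.
Qed.

(** The left side of [jordan_identity_polarized] is symmetric in all four
    arguments, so exchanging [a] and [b] does not change its right side; the
    resulting equation is the derivation rule for [[L_a, L_b]]. *)
Lemma Der_bracket_Lmul (a b : V) : Der (bracket (Lmul a) (Lmul b)).
Proof.
move=> u v; rewrite !bracketE /=.
have := jordan_identity_polarized b u v a.
have := jordan_identity_polarized a u v b.
have -> : jmul (jmul a u) (jmul v b) + jmul (jmul u v) (jmul a b)
    + jmul (jmul v a) (jmul u b)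
  = jmul (jmul b u) (jmul v a) + jmul (jmul u v) (jmul b a)
    + jmul (jmul v b) (jmul u a).
  rewrite (jmulC (jmul a u)) (jmulC (jmul v a)) (jmulC b a).
  rewrite (jmulC a u) (jmulC b u); cancel_terms.
move=> -> /eqP; rewrite -subr_eq0 => /eqP E.
apply/eqP; rewrite -subr_eq0; apply/eqP; rewrite -[RHS]E.
rewrite jmulBl jmulBr (jmulC (jmul a _)) (jmulC (jmul b _)).
rewrite (jmulC (jmul u v)) (jmulC (jmul u v)) (jmulC (jmul b u)).
rewrite (jmulC (jmul a u)) (jmulC (jmul v a)) (jmulC (jmul v b)).
rewrite (jmulC v b) (jmulC v a); cancel_terms.
Qed.

Lemma Der_one D : Der D -> D (jone : V) = 0.
Proof.
move=> /(_ jone jone); rewrite (jmulC (D _)) !jmul1 => /eqP.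
by rewrite -subr_eq0 opprD addrA subrr sub0r oppr_eq0 => /eqP.
Qed.

Lemma DerD D1 D2 : Der D1 -> Der D2 -> Der (D1 + D2).
Proof.
move=> h1 h2 u v; rewrite !bop_addE h1 h2 jmulDl jmulDr; exact: addrACA.
Qed.

Lemma DerZ (a : R) D : Der D -> Der (a *: D).
Proof.
by move=> h u v; rewrite !bop_scaleE h scalerDr !(jmulC (a *: _)) !linearZ /=
  (jmulC v).
Qed.

Lemma DerN D : Der D -> Der (- D).
Proof. by rewrite -scaleN1r; exact: DerZ. Qed.

Lemma Der_bracket D1 D2 : Der D1 -> Der D2 -> Der (bracket D1 D2).
Proof.
move=> h1 h2 u v; rewrite !bracketE.
rewrite h1 h2 !bop_morphD !h1 !h2 jmulBl jmulBr; cancel_terms.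
Qed.

Lemma bracket_Der_Lmul D x : Der D -> bracket D (Lmul x) = Lmul (D x).
Proof.
move=> h; apply: bopE => u.
by rewrite !bracketE /= h addrK.
Qed.

(** Evaluation at the unit recovers [x] from [L_x + D]. *)
Lemma Lmul_add_Der_inj x x' D D' : Der D -> Der D' ->
  Lmul x + D = Lmul x' + D' -> Lmul x = Lmul x' /\ D = D'.
Proof.
move=> h h' E; have xx' : x = x'.
  have := congr1 (fun A : bop V => A jone) E.
  by rewrite !bop_addE /= !Der_one// !addr0 !(jmulC _ jone) !jmul1.
by split; [rewrite xx'|move: E; rewrite xx' => /addrI].
Qed.

Lemma dagger_add x D : Der D -> dagger (Lmul x + D) = Lmul x - D.
Proof.
move=> h; apply: xget_unique; first by exists x, D.
move=> K [x' [D' [h' E ->]]].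
by have [-> ->] := Lmul_add_Der_inj _ _ _ _ h h' E.
Qed.

(** The second summand on the right is the discrepancy between the connection
    and the left-invariant derivative; its two groups of terms lie in the
    multiplications and in the derivations respectively. *)
Lemma christoffel_translate (g : bop V) y x d D : GL g -> Der d -> Der D ->
  christoffel g (g * (Lmul y + d)) (g * (Lmul x + D))
  = g * ((Lmul y + d) * (Lmul x + D)
         + ((- (3 / 2 *: bracket d (Lmul x)) + 2^-1 *: bracket (Lmul y) D)
            + (- (2^-1 *: bracket (Lmul y) (Lmul x)) - 2^-1 *: bracket d D))).
Proof.
move=> GLg hd hD.
rewrite /christoffel !bop_invK// !dagger_add// bop_scaleAr; congr (_ * _).
have two0 : (2 : R) != 0 by rewrite pnatr_eq0.
(* Doubling turns every coefficient into an integer; the coefficient 3 is then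
   written out as repeated addition. *)
apply: (scalerI two0).
rewrite /bracket scalerA mulfV// scale1r !(scalerDr, scalerN) !scalerA.
rewrite (mulrCA 2) !mulfV// mulr1 !scale1r.
rewrite (_ : 3 = 1 + (1 + 1) :> R)// (_ : 2 = 1 + 1 :> R)// !scalerDl !scale1r.
rewrite !(mulrDl, mulrDr, mulrN, mulNr).
cancel_terms.
Qed.

End JordanOperators.

(** * Limits and derivatives along an interval *)

Section DerivativesOnIntervals.
Context {R : realType}.

(** This makes derivatives relative to [J] unique: [t] is a limit point of [J],
    being approached along the segment from [t] to another point of [J]. *)
Lemma within_dnbhs_proper (J : set R) (t : R) : is_interval J ->
  (exists a b, [/\ J a, J b & a < b]) -> J t -> ProperFilter (within J t^').
Proof.
move=> Jint [a [b [Ja Jb ab]]] Jt.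
have [c Jc ct] : exists2 c, J c & c - t != 0.
  have [ta|ta] := eqVneq t a.
    by exists b; rewrite // subr_eq0 ta gt_eqF.
  by exists a; rewrite // subr_eq0 eq_sym.
apply: Build_ProperFilter_ex => A; rewrite /within /= => tA.
pose h (th : R) := t + th * (c - t).
have h0 : h th @[th --> 0^'+] --> t.
  rewrite -[X in _ --> X]addr0 -[X in _ + X](mul0r (c - t)).
  apply: cvgD; first exact: cvg_cst.
  apply: cvgMl; apply: cvg_at_right_filter; exact: cvg_id.
have [th th0 [th1 hA]] : exists2 th : R, 0 < th &
    th < 1 /\ (h th != t -> J (h th) -> A (h th)).
  have /filter_ex[th [th0 thP]] : \forall th \near (0 : R)^'+,
      0 < th /\ (th < 1 /\ (h th != t -> J (h th) -> A (h th))).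
    near=> th; split; first by [].
    split; first by near: th; exact: nbhs_right_lt.
    by near: th; exact: h0 tA.
  by exists th.
exists (h th); apply: hA.
  by rewrite -subr_eq0 /h addrAC subrr add0r mulf_neq0// gt_eqF.
have [tc|/ltW tc] := leP t c.
  apply: (Jint t c) => //; rewrite /h lerDl mulr_ge0 ?subr_ge0 ?(ltW th0)//=.
  by rewrite -lerBrDl ler_piMl ?subr_ge0// ltW.
apply: (Jint c t) => //; rewrite /h gerDl mulr_ge0_le0 ?subr_le0 ?(ltW th0)//.
by rewrite andbT -lerBlDl ler_niMl ?subr_le0 ?tc// ltW.
Unshelve. all: by end_near. Qed.

Context {V : normedModType R}.

Lemma additive_bounded_cvg {T : Type} {F : set_system T} {FF : Filter F}
    {W1 W2 : normedModType R} (f : W1 -> W2) (M : R) (g : T -> W1) (l : W1) :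
  {morph f : u v / u - v} -> (forall w, `|f w| <= M * `|w|) ->
  g s @[s --> F] --> l -> f (g s) @[s --> F] --> f l.
Proof.
move=> fB fM gl; apply/subr_cvg0; apply: norm_cvg0.
apply: (@squeeze_cvgr _ _ _ _ (fun=> 0) (fun s => M * `|g s - l|)).
- by near=> s; rewrite normr_ge0 -fB fM.
- exact: cvg_cst.
- rewrite -(mulr0 M); apply: cvgMr; apply/norm_cvg0P; exact/subr_cvg0.
Unshelve. all: by end_near. Qed.

Lemma bop_eval_cvg {T : Type} {F : set_system T} {FF : Filter F}
    (A : T -> bop V) (B : bop V) (x : V) :
  A s @[s --> F] --> B -> A s x @[s --> F] --> B x.
Proof.
apply: (@additive_bounded_cvg _ _ _ _ _ (fun C : bop V => C x) `|x|) => //.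
by move=> C; rewrite mulrC; exact: opnormP.
Qed.

Lemma bop_cvgM {T : Type} {F : set_system T} {FF : Filter F}
    (f g : T -> bop V) (a b : bop V) :
  f s @[s --> F] --> a -> g s @[s --> F] --> b ->
  f s * g s @[s --> F] --> a * b.
Proof.
move=> fa gb; apply/subr_cvg0; apply: norm_cvg0.
apply: (@squeeze_cvgr _ _ _ _ (fun=> 0)
  (fun s => `|f s - a| * `|g s| + `|a| * `|g s - b|)).
- near=> s; rewrite normr_ge0 /=.
  have -> : f s * g s - a * b = (f s - a) * g s + a * (g s - b).
    by rewrite mulrBl mulrBr addrA subrK.
  by rewrite (le_trans (ler_normD _ _))// lerD// opnormM.
- exact: cvg_cst.
- rewrite -[X in _ --> X]addr0 -[X in X + _](mul0r `|b|).
  rewrite -[X in _ + X](mulr0 `|a|); apply: cvgD.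
    apply: cvgM; last exact: cvg_norm.
    by apply/norm_cvg0P; exact/subr_cvg0.
  by apply: cvgMr; apply/norm_cvg0P; exact/subr_cvg0.
Unshelve. all: by end_near. Qed.

Lemma derive_on_eq (W : normedModType R) (J : set R) (f : R -> W) t l :
  ProperFilter (within J t^') ->
  diff_quot f t s @[s --> within J t^'] --> l -> derive_on J f t = l.
Proof. by move=> FF; apply: cvg_lim => //; exact: norm_hausdorff. Qed.

Lemma diff_quot_cvgD (W : normedModType R) (J : set R) (f g : R -> W) (t : R)
    (a b : W) :
  diff_quot f t s @[s --> within J t^'] --> a ->
  diff_quot g t s @[s --> within J t^'] --> b ->
  diff_quot (fun s => f s + g s) t s @[s --> within J t^'] --> a + b.
Proof.
move=> fa gb.
have -> : diff_quot (fun s => f s + g s) t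
    = fun s => diff_quot f t s + diff_quot g t s.
  by apply/funext => s; rewrite /diff_quot -scalerDr opprD addrACA.
exact: cvgD.
Qed.

(** Leibniz' rule, from the usual splitting
    [f s g s - f t g t = (f s - f t) g s + f t (g s - g t)]. *)
Lemma diff_quot_cvgM (J : set R) (f g : R -> bop V) (t : R) (a b : bop V) :
  diff_quot f t s @[s --> within J t^'] --> a ->
  diff_quot g t s @[s --> within J t^'] --> b ->
  diff_quot (fun s => f s * g s) t s @[s --> within J t^'] -->
    a * g t + f t * b.
Proof.
move=> fa gb.
(* Differentiability gives continuity of [g] at [t] along [J]. *)
have tt : (s : R) - t @[s --> within J t^'] --> (0 : R).
  apply/subr_cvg0; apply: cvg_trans (cvg_within _) _; exact: nbhs_dnbhs.
have gt : g s @[s --> within J t^'] --> g t.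
  have -> : g = fun s => g t + (s - t) *: diff_quot g t s.
    apply/funext => s; rewrite /diff_quot; have [->|st] := eqVneq s t.
      by rewrite subrr scale0r addr0.
    by rewrite scalerA mulfV ?subr_eq0// scale1r subrKC.
  rewrite [X in _ --> X](_ : _ = g t + 0 *: b); last first.
    by rewrite /diff_quot subrr !scale0r.
  by apply: cvgD; [exact: cvg_cst|exact: cvgZ].
have -> : diff_quot (fun s => f s * g s) t
    = fun s => diff_quot f t s * g s + f t * diff_quot g t s.
  apply/funext => s; rewrite /diff_quot -bop_scaleAl -bop_scaleAr -scalerDr.
  by rewrite mulrBl mulrBr addrA subrK.
by apply: cvgD; apply: bop_cvgM => //; exact: cvg_cst.
Qed.

End DerivativesOnIntervals.

Section DerivativesOfJordanOperators.
Context {R : realType} {V : jbAlgType R}.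

Lemma Lmul_cvg {T : Type} {F : set_system T} {FF : Filter F}
    (x : T -> V) (l : V) :
  x s @[s --> F] --> l -> Lmul (x s) @[s --> F] --> Lmul l.
Proof.
apply: (@additive_bounded_cvg _ _ _ _ _ _ (@Lmul R V) 1); first exact: LmulB.
move=> w; rewrite mul1r; apply: opnorm_le => // u; exact: jnormM.
Qed.

Lemma diff_quot_Lmul_cvg (J : set R) (x : R -> V) (t : R) (l : V) :
  diff_quot x t s @[s --> within J t^'] --> l ->
  diff_quot (fun s => Lmul (x s)) t s @[s --> within J t^'] --> Lmul l.
Proof.
move=> xl.
have -> : diff_quot (fun s => Lmul (x s)) t = fun s => Lmul (diff_quot x t s).
  by apply/funext => s; rewrite /diff_quot LmulZ LmulB.
exact: Lmul_cvg.
Qed.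

(** The derivation rule is an equation between continuous functions of the
    operator. *)
Lemma Der_closed_cvg {T : Type} {F : set_system T} {FF : ProperFilter F}
    (A : T -> bop V) (B : bop V) :
  (\forall s \near F, Der (A s)) -> A s @[s --> F] --> B -> Der B.
Proof.
move=> FA AB u v.
have mulcvg w (q : T -> V) l : q s @[s --> F] --> l ->
    jmul w (q s) @[s --> F] --> jmul w l.
  by apply: (@additive_bounded_cvg _ _ _ _ _ _ (jmul w) `|w|);
    [exact: linearB|exact: jnormM].
have lhs : A s (jmul u v) @[s --> F] --> B (jmul u v) by exact: bop_eval_cvg.
have rhs : jmul v (A s u) + jmul u (A s v) @[s --> F] -->
    jmul v (B u) + jmul u (B v).
  by apply: cvgD; apply: mulcvg; exact: bop_eval_cvg.
rewrite (jmulC (B u)) -(cvg_lim (@norm_hausdorff _ V) lhs).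
apply: (cvg_lim (@norm_hausdorff _ V)); apply: cvg_trans rhs.
apply: near_eq_cvg; near=> s.
have As : Der (A s) by near: s.
by rewrite (jmulC v) As.
Unshelve. all: by end_near. Qed.

Lemma Der_derive_on (J : set R) (D : R -> bop V) t :
  ProperFilter (within J t^') -> (forall s, J s -> Der (D s)) -> J t ->
  derivable_on J D t -> Der (derive_on J D t).
Proof.
move=> FF hD Jt; apply: Der_closed_cvg.
near=> s; apply: DerZ; apply: DerD; first by apply: hD; near: s; exact: withinT.
by apply: DerN; exact: hD.
Unshelve. all: by end_near. Qed.

End DerivativesOfJordanOperators.

(** * The equations of parallel transport *)

Theorem proposition3p10 (R : realType) (V : jbAlgType R)
  (J : set R) (J_interval : is_interval J)
  (J_nondegenerate : exists a b : R, [/\ J a, J b & a < b])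
  (gamma : R -> bop V) (gamma_Str : forall t, J t -> Str (gamma t))
  (gamma_smooth : smooth_on J gamma)
  (y : R -> V) (d : R -> bop V) (d_Der : forall t, J t -> Der (d t))
  (v_decomp : forall t, J t ->
    bop_inv (gamma t) * derive_on J gamma t = Lmul (y t) + d t)
  (x : R -> V) (x_smooth : smooth_on J x)
  (D : R -> bop V) (D_Der : forall t, J t -> Der (D t))
  (D_smooth : smooth_on J D) :
  parallel_along J gamma (fun t => gamma t * (Lmul (x t) + D t)) <->
  (forall t, J t ->
    eq_inside Lset (derive_on J (fun s => Lmul (x s)) t)
      (- (3 / 2 *: bracket (d t) (Lmul (x t)))
       + 2^-1 *: bracket (Lmul (y t)) (D t))
    /\
    eq_inside Der (derive_on J D t)
      (- (2^-1 *: bracket (Lmul (y t)) (Lmul (x t)))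
       - 2^-1 *: bracket (d t) (D t))).
Proof.
(* Both conditions are imposed separately at each time. *)
suff pointwise t : J t ->
    derive_on J (fun s => gamma s * (Lmul (x s) + D s)) t
      = christoffel (gamma t) (derive_on J gamma t)
          (gamma t * (Lmul (x t) + D t)) <->
    eq_inside Lset (derive_on J (fun s => Lmul (x s)) t)
      (- (3 / 2 *: bracket (d t) (Lmul (x t)))
       + 2^-1 *: bracket (Lmul (y t)) (D t))
    /\
    eq_inside Der (derive_on J D t)
      (- (2^-1 *: bracket (Lmul (y t)) (Lmul (x t)))
       - 2^-1 *: bracket (d t) (D t)).
  by split=> H t Jt; apply/(pointwise t Jt)/H.
move=> Jt.
have FF := within_dnbhs_proper _ _ J_interval J_nondegenerate Jt.
have [GLg _] := gamma_Str t Jt; have [gV _] := bop_invP _ GLg.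
have dgamma : derivable_on J gamma t := gamma_smooth 0%N t Jt.
have gammaE : derive_on J gamma t = gamma t * (Lmul (y t) + d t).
  by rewrite -v_decomp// mulrA gV mul1r.
have dx : derivable_on J x t := x_smooth 0%N t Jt.
have dLx := diff_quot_Lmul_cvg _ _ _ _ dx.
have dD : derivable_on J D t := D_smooth 0%N t Jt.
have LxE : derive_on J (fun s => Lmul (x s)) t = Lmul (derive_on J x t).
  exact: derive_on_eq dLx.
have hD' : Der (derive_on J D t) by exact: Der_derive_on.
have muE : derive_on J (fun s => gamma s * (Lmul (x s) + D s)) t
    = derive_on J gamma t * (Lmul (x t) + D t)
      + gamma t * (Lmul (derive_on J x t) + derive_on J D t).
  apply: derive_on_eq; apply: diff_quot_cvgM => //.
  exact: diff_quot_cvgD dLx dD.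
have [hd hD] := (d_Der t Jt, D_Der t Jt).
have LP : - (3 / 2 *: bracket (d t) (Lmul (x t)))
    + 2^-1 *: bracket (Lmul (y t)) (D t)
    = Lmul (- (3 / 2 *: d t (x t)) - 2^-1 *: D t (y t)).
  rewrite bracket_Der_Lmul// (bracketC _ (D t)) bracket_Der_Lmul//.
  by rewrite scalerN LmulB -[in RHS]scaleNr !LmulZ scaleNr.
have DP : Der (- (2^-1 *: bracket (Lmul (y t)) (Lmul (x t)))
    - 2^-1 *: bracket (d t) (D t)).
  apply: DerD; apply: DerN; apply: DerZ; first exact: Der_bracket_Lmul.
  exact: Der_bracket.
rewrite muE gammaE christoffel_translate// -mulrA -mulrDr LxE.
split=> [E|[[_ _ EL] [_ _ ED]]]; last by rewrite EL ED.
have {}E : Lmul (derive_on J x t) + derive_on J D t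
    = - (3 / 2 *: bracket (d t) (Lmul (x t)))
      + 2^-1 *: bracket (Lmul (y t)) (D t)
      + (- (2^-1 *: bracket (Lmul (y t)) (Lmul (x t)))
         - 2^-1 *: bracket (d t) (D t)).
  have := congr1 (fun A => bop_inv (gamma t) * A) E.
  by rewrite !bop_invK// => /addrI.
move: E; rewrite LP => /(Lmul_add_Der_inj _ _ _ _ hD' DP)[EL ED].
by split; split=> //; exact: imageT.
Qed.
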